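(* Let $\mathbb K$ be an algebraically closed field of characteristic $2$ and let $n\ge4$. The type-1 Kaplansky algebra $\mathrm{Kap}_1(n)$ is isomorphic to $\mathfrak{lh}_I'(n)$, the derived algebra of $\mathfrak{lh}_I(n)$, via the assignment $$e_u\longleftrightarrow\prod_{1\le i\le n}(1+z_i)^{u_i}$$ of generating functions (modulo constants), where $u=(u_1,\dots,u_n)$.
   Context: Type-1 Kaplansky algebra: let $V=\mathbb F_2^n$ with the nondegenerate non-alternating inner product $B(u,v)=\sum_iu_iv_i$, let $e^1,\dots,e^n$ be the standard orthonormal basis, and let $e=e^1+\dots+e^n$. Let $\Gamma=V\setminus\{0,e\}$. $\mathrm{Kap}_1(n)$ is the Lie algebra over $\mathbb K$ with basis $\{e_u\mid u\in\Gamma\}$ and bracket $[e_u,e_v]=B(u,v)e_{u+v}$ if $u\neq v$ and $u+v\in\Gamma$, and $[e_u,e_v]=0$ if $u+v\notin\Gamma$ or $u=v$. Exponents $u_i\in\{0,1\}$. Let $\mathcal O(n;\underline N_s)=\mathbb K[z_1,\dots,z_n]/(z_1^2,\dots,z_n^2)$, where $\underline N_s=(1,\dots,1)$, with the usual partial derivatives $\partial_{z_i}$. Let $\mathfrak{vect}(n;\underline N_s)$ be the Lie algebra of vector fields $\sum f_i\partial_{z_i}$, $f_i\in\mathcal O(n;\underline N_s)$, graded by $\deg z_i=1$. $\mathfrak{lh}_I(n)=(W,\mathfrak o_I'(W))_{*,\underline N_s}$ is the Cartan prolong: the graded subalgebra $\bigoplus_{k\ge-1}\mathfrak g_k$ of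 $\mathfrak{vect}(n;\underline N_s)$ with $\mathfrak g_{-1}=W=\mathrm{Span}(\partial_{z_1},\dots,\partial_{z_n})$, with $\mathfrak g_0=\mathfrak o_I'(W)$ the derived algebra of the orthogonal Lie algebra preserving the form with identity Gram matrix (i.e. the Lie algebra of symmetric zero-diagonal $n\times n$ matrices), and with $\mathfrak g_k=\{D\in\mathfrak{vect}(n;\underline N_s)_k\mid[D,\mathfrak g_{-1}]\subset\mathfrak g_{k-1}\}$ for $k\ge1$. Its elements are expressed by generating functions $F$ (modulo constants) via $H_F=\sum_i\partial_{z_i}F\,\partial_{z_i}$, and in these terms the bracket is $\{F,G\}_I=\sum_{1\le i\le n}\partial_{z_i}F\cdot\partial_{z_i}G$. *)

(* Defs.v *)
From HB Require Import structures.
From mathcomp Require Import all_boot all_order all_algebra.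

Set Implicit Arguments.
Unset Strict Implicit.
Unset Printing Implicit Defensive.

Import GRing.Theory.
Local Open Scope ring_scope.

(* O(n; N_s) = K[z_1, ..., z_n] / (z_1^2, ..., z_n^2): an element is stored as its
   family of coefficients on the monomial basis z_S = \prod_(i in S) z_i, S a
   subset of 'I_n (see [trunc_decomp]).  The product is determined by
   z_A z_B = z_(A :|: B) if A and B are disjoint, and z_A z_B = 0 otherwise. *)
Definition trunc (K : fieldType) (n : nat) : Type := {ffun {set 'I_n} -> K^o}.

HB.instance Definition _ (K : fieldType) (n : nat) :=
  Vector.copy (trunc K n) {ffun {set 'I_n} -> K^o}.

Definition zmon {K : fieldType} {n : nat} (S : {set 'I_n}) : trunc K n :=
  [ffun A => (A == S)%:R].

Definition trunc_mul_coef {K : fieldType} {n : nat} (f g : {set 'I_n} -> K)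
    (S : {set 'I_n}) : K :=
  \sum_(A : {set 'I_n} | A \subset S) f A * g (S :\: A).

Lemma trunc_mul_coefC (K : fieldType) (n : nat) (f g : {set 'I_n} -> K)
    (S : {set 'I_n}) :
  trunc_mul_coef f g S = trunc_mul_coef g f S.
Proof.
rewrite /trunc_mul_coef.
rewrite (reindex_onto (fun A => S :\: A) (fun A => S :\: A)) /=; last first.
  by move=> A AS; rewrite setDDr setDv set0U; apply/setIidPr.
apply: eq_big => [A|A /andP[_ /eqP AK]]; last by rewrite AK mulrC.
rewrite subsetDl setDDr setDv set0U /=.
by apply/eqP/idP => /setIidPr.
Qed.

Lemma trunc_mul_coefA (K : fieldType) (n : nat) (f g h : {set 'I_n} -> K)
    (S : {set 'I_n}) :
  trunc_mul_coef f (trunc_mul_coef g h) S = trunc_mul_coef (trunc_mul_coef f g) h S.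
Proof.
rewrite /trunc_mul_coef.
under eq_bigr => A _ do rewrite big_distrr /=.
under [in RHS]eq_bigr => C _ do rewrite big_distrl /=.
rewrite [RHS](exchange_big_dep (fun A : {set 'I_n} => A \subset S)) /=; last first.
  by move=> C A CS AsubC; apply: subset_trans AsubC CS.
apply: eq_bigr => A AS.
rewrite [RHS](reindex_onto (fun B => A :|: B) (fun C => C :\: A)) /=; last first.
  by move=> C /andP[_ AsubC]; rewrite setDE setUIr setUCr setIT; apply/setUidPr.
apply: eq_big => [B|B BS]; last first.
  have dAB : [disjoint B & A] by move: BS; rewrite subsetD => /andP[].
  rewrite setDUl setDv set0U -setDDl.
  have -> : B :\: A = B by apply/setDidPl.
  by rewrite mulrA.
rewrite subUset AS subsetUl andbT /= setDUl setDv set0U subsetD.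
by congr (_ && _); apply/setDidPl/eqP.
Qed.

Lemma eq_trunc_mul_coef (K : fieldType) (n : nat) (f f' g g' : {set 'I_n} -> K) :
  f =1 f' -> g =1 g' -> trunc_mul_coef f g =1 trunc_mul_coef f' g'.
Proof. by move=> ff gg S; apply: eq_bigr => A _; rewrite ff gg. Qed.

Definition trunc_mul {K : fieldType} {n : nat} (f g : trunc K n) : trunc K n :=
  [ffun S => trunc_mul_coef f g S].

Lemma trunc_mulC (K : fieldType) (n : nat) : commutative (@trunc_mul K n).
Proof. by move=> f g; apply/ffunP=> S; rewrite !ffunE trunc_mul_coefC. Qed.

Lemma trunc_mulA (K : fieldType) (n : nat) : associative (@trunc_mul K n).
Proof.
move=> f g h; apply/ffunP=> S; rewrite !ffunE.
have gh : trunc_mul g h =1 trunc_mul_coef g h by move=> T; rewrite ffunE.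
have fg : trunc_mul f g =1 trunc_mul_coef f g by move=> T; rewrite ffunE.
rewrite (eq_trunc_mul_coef (frefl _) gh) trunc_mul_coefA.
exact: eq_trunc_mul_coef.
Qed.

Lemma trunc_mul1 (K : fieldType) (n : nat) : left_id (zmon set0) (@trunc_mul K n).
Proof.
move=> f; apply/ffunP=> S; rewrite ffunE /trunc_mul_coef (bigD1 set0) ?sub0set //=.
rewrite ffunE eqxx mul1r setD0 big1 ?addr0 // => A /andP[_ /negPf A0].
by rewrite ffunE A0 mul0r.
Qed.

Lemma trunc_mulDl (K : fieldType) (n : nat) :
  left_distributive (@trunc_mul K n) +%R.
Proof.
move=> f g h; apply/ffunP=> S; rewrite !ffunE -big_split /=.
by apply: eq_bigr => A _; rewrite ffunE mulrDl.
Qed.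

Lemma trunc_1neq0 (K : fieldType) (n : nat) : (zmon set0 : trunc K n) != 0.
Proof. by apply/eqP => /ffunP/(_ set0)/eqP; rewrite !ffunE eqxx oner_eq0. Qed.

HB.instance Definition _ (K : fieldType) (n : nat) :=
  GRing.Zmodule_isComNzRing.Build (trunc K n) (@trunc_mulA K n) (@trunc_mulC K n)
    (@trunc_mul1 K n) (@trunc_mulDl K n) (@trunc_1neq0 K n).

Lemma trunc_scaleAl (K : fieldType) (n : nat) (a : K) (f g : trunc K n) :
  a *: (f * g) = (a *: f) * g.
Proof.
apply/ffunP=> S; rewrite !ffunE scaler_sumr.
by apply: eq_bigr => A _; rewrite ffunE -scalerAl.
Qed.

HB.instance Definition _ (K : fieldType) (n : nat) :=
  GRing.Lmodule_isLalgebra.Build K (trunc K n) (@trunc_scaleAl K n).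
HB.instance Definition _ (K : fieldType) (n : nat) :=
  GRing.Lalgebra_isComAlgebra.Build K (trunc K n).

Definition zvar {K : fieldType} {n : nat} (i : 'I_n) : trunc K n := zmon [set i].

Lemma zmonM (K : fieldType) (n : nat) (A B : {set 'I_n}) :
  zmon A * zmon B = (if [disjoint A & B] then zmon (A :|: B) else 0) :> trunc K n.
Proof.
apply/ffunP=> S; rewrite ffunE /trunc_mul_coef.
have [AS|nAS] := boolP (A \subset S); last first.
  rewrite big1 => [|C CS]; last first.
    rewrite ffunE; case: eqP => [CA|]; last by rewrite mul0r.
    by rewrite -CA CS in nAS.
  case: ifP; rewrite ffunE // => _; case: eqP => // SAB.
  by rewrite SAB subsetUl in nAS.
rewrite (bigD1 A) //= [zmon A A]ffunE eqxx mul1r big1 => [|C /andP[_ /negPf CA]]; last first.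
  by rewrite ffunE CA mul0r.
rewrite addr0 ffunE; case: ifP => dAB; rewrite ffunE.
  congr (_%:R); congr nat_of_bool; apply/eqP/eqP => [<-|->].
    by rewrite setDE setUIr setUCr setIT; apply/esym/setUidPr.
  by rewrite setDUl setDv set0U; apply/setDidPl; rewrite disjoint_sym.
case: eqP => // SAB; move: dAB; rewrite -SAB disjoint_sym disjoints_subset.
by rewrite setDE subsetIr.
Qed.

Lemma zvar_sqr (K : fieldType) (n : nat) (i : 'I_n) : zvar i ^+ 2 = 0 :> trunc K n.
Proof. by rewrite expr2 zmonM disjoints1 inE eqxx. Qed.

Lemma zmonE (K : fieldType) (n : nat) (S : {set 'I_n}) :
  zmon S = \prod_(i in S) zvar i :> trunc K n.
Proof.
elim: {S}#|S| {-2}S (eqxx #|S|) => [|m IHm] S.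
  by rewrite cards_eq0 => /eqP->; rewrite big_set0.
move=> cS; have /card_gt0P[i iS] : (0 < #|S|)%N by rewrite (eqP cS).
rewrite (big_setD1 i iS) /= -IHm; last first.
  by move: cS; rewrite (cardsD1 i S) iS eqSS.
by rewrite zmonM disjoints1 !inE eqxx /= setD1K.
Qed.

Lemma trunc_decomp (K : fieldType) (n : nat) (f : trunc K n) :
  f = \sum_(S : {set 'I_n}) (f S : K) *: \prod_(i in S) zvar i.
Proof.
apply/ffunP=> A; rewrite sum_ffunE (bigD1 A) //= -zmonE !ffunE eqxx.
rewrite [_ *: _]mulr1 big1 ?addr0 // => S SA.
by rewrite -zmonE !ffunE eq_sym (negPf SA) scaler0.
Qed.

(* d/dz_i: z_(i |: S) goes to z_S if i is not in S, and monomials without z_i go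
   to 0.  It is a derivation when K has characteristic 2. *)
Definition pderiv {K : fieldType} {n : nat} (i : 'I_n) (f : trunc K n) : trunc K n :=
  [ffun S : {set 'I_n} => if i \in S then 0 else f (i |: S)].

Lemma pderivM (K : fieldType) (char2 : 2%N \in [pchar K]) (n : nat) (i : 'I_n)
    (f g : trunc K n) :
  pderiv i (f * g) = pderiv i f * g + f * pderiv i g.
Proof.
have addKK (a : K) : a + a = 0 by rewrite -mulr2n -mulr_natr (pcharf0 char2) mulr0.
apply/ffunP=> S; rewrite !ffunE /trunc_mul_coef -big_split /=; case: ifPn => iS.
  rewrite (bigID (fun A : {set 'I_n} => i \in A)) /=.
  rewrite [X in _ = _ + X](reindex_onto (fun A => A :\ i) (fun A => i |: A)) /=;
    last by move=> A /andP[_ iA]; rewrite setU1K.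
  rewrite [X in _ = _ + X](eq_bigl (fun A : {set 'I_n} => (A \subset S) && (i \in A)));
    last first.
    move=> A; rewrite !inE eqxx andbT; have [iA|iA] := boolP (i \in A).
      by rewrite setD1K // eqxx !andbT -{2}(setD1K iA) subUset sub1set iS.
    rewrite andbF; apply/negP => /andP[_ /eqP E].
    by move: iA; rewrite -E !inE eqxx.
  rewrite -big_split big1 // => A /andP[AS iA] /=.
  rewrite !ffunE iA !inE iA iS eqxx /= mul0r add0r mulr0 addr0 setD1K //.
  by rewrite setDDr [S :&: _](setIidPr _) ?sub1set // [_ :|: [set i]]setUC addKK.
rewrite (bigID (fun A : {set 'I_n} => i \in A)) /= big_split /=; congr (_ + _).
  rewrite (reindex_onto (fun A => i |: A) (fun A => A :\ i)) /=; last first.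
    by move=> A /andP[_ iA]; rewrite setD1K.
  apply: eq_big => [A|A /andP[_ /eqP E]].
    rewrite !inE eqxx /= andbT; have [iA|iA] := boolP (i \in A).
      rewrite [LHS]andbC; case: eqP => [E|_] /=.
        by move: iA; rewrite -E !inE eqxx.
      by apply/esym/negbTE/negP => /subsetP/(_ i iA); apply/negP.
    rewrite setU1K // eqxx andbT; apply/subsetP/subsetP => sA j jA.
      have := sA j; rewrite !inE jA orbT => /(_ isT)/orP[/eqP ji|//].
      by rewrite ji (negPf iA) in jA.
    by move: jA; rewrite !inE => /orP[->//|/sA->]; rewrite orbT.
  have iA : i \notin A by rewrite -E !inE eqxx.
  rewrite !ffunE (negPf iA); congr (f _ * g _); apply/setP => j; rewrite !inE.
  by case: eqP => [->|_] //=; rewrite (negPf iS) andbF.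
apply: eq_big => [A|A /andP[AS iA]].
  apply/andP/idP => [[sA iA]|sA].
    apply/subsetP=> j jA; have := subsetP sA j jA; rewrite !inE => /orP[/eqP ji|//].
    by rewrite ji (negPf iA) in jA.
  split; first by apply: subset_trans sA (subsetUr _ _).
  by apply: contra iS; apply: (subsetP sA).
rewrite !ffunE !inE (negPf iS) andbF; congr (f _ * g _); apply/setP => j.
by rewrite !inE; case: eqP => [->|_] //=; rewrite iA.
Qed.

(* The linear span of the brackets of elements of L, as the smallest subspace
   containing them. *)
Definition derived {K : fieldType} {V : vectType K} (br : V -> V -> V)
    (L : V -> Prop) (x : V) : Prop :=
  forall U : {vspace V},
    (forall a b, L a -> L b -> br a b \in U) -> x \in U.

(* [D : vect K n] is the vector field \sum_i D i d/dz_i. *)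
Notation vect K n := {ffun 'I_n -> trunc K n}.

Definition partial {K : fieldType} {n : nat} (i : 'I_n) : vect K n :=
  [ffun j => (j == i)%:R].

Definition vect_bracket {K : fieldType} {n : nat} (D E : vect K n) : vect K n :=
  [ffun j => \sum_(i < n) (D i * pderiv i (E j) - E i * pderiv i (D j))].

(* D is homogeneous of degree d - 1 for the grading deg z_i = 1, that is, its
   coefficients are homogeneous of degree d. *)
Definition vect_homog {K : fieldType} {n : nat} (d : nat) (D : vect K n) : Prop :=
  forall (i : 'I_n) (S : {set 'I_n}), D i S != 0 -> #|S| = d.

Definition mx_bracket {K : fieldType} {n : nat} (A B : 'M[K]_n) : 'M[K]_n :=
  A *m B - B *m A.

(* Infinitesimal preservation of the form with Gram matrix 1; in characteristic 2
   this says that A is symmetric. *)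
Definition oI (K : fieldType) (n : nat) (A : 'M[K]_n) : Prop :=
  A^T *m 1%:M + 1%:M *m A = 0.

(* The matrix Lie algebra is realized in degree 0 through its action on W: D is
   the linear vector field whose adjoint action on W has matrix A in the basis
   d/dz_1, ..., d/dz_n. *)
Definition acts_on_W {K : fieldType} {n : nat} (D : vect K n) (A : 'M[K]_n) : Prop :=
  vect_homog 1 D /\
  forall j, vect_bracket D (partial j) = \sum_(i < n) A i j *: partial i.

Definition oI' (K : fieldType) (n : nat) (D : vect K n) : Prop :=
  exists2 A, derived mx_bracket (@oI K n) A & acts_on_W D A.

Definition W (K : fieldType) (n : nat) (D : vect K n) : Prop :=
  D \in <<[seq partial i | i : 'I_n]>>%VS.

(* [prolong_comp g0 d] is the component of degree d - 1 of (W, g0)_*. *)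
Fixpoint prolong_comp {K : fieldType} {n : nat} (g0 : vect K n -> Prop) (d : nat)
    (D : vect K n) : Prop :=
  match d with
  | 0 => W D
  | d'.+1 =>
      if d' == 0%N then g0 D
      else vect_homog d D /\
           forall E, W E -> prolong_comp g0 d' (vect_bracket D E)
  end.

(* The direct sum of the components, inside [vect K n]. *)
Definition prolong {K : fieldType} {n : nat} (g0 : vect K n -> Prop)
    (D : vect K n) : Prop :=
  exists (m : nat) (c : nat -> vect K n),
    (forall d, prolong_comp g0 d (c d)) /\ D = \sum_(d < m) c d.

Definition lhI (K : fieldType) (n : nat) : vect K n -> Prop := prolong (@oI' K n).
Arguments lhI : clear implicits.

Definition lhI' (K : fieldType) (n : nat) : vect K n -> Prop :=
  derived vect_bracket (lhI K n).
Arguments lhI' : clear implicits.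

Definition hamilton {K : fieldType} {n : nat} (F : trunc K n) : vect K n :=
  [ffun i => pderiv i F].

Definition kapB {n : nat} (u v : 'rV['F_2]_n) : 'F_2 := \sum_(i < n) u 0 i * v 0 i.

(* V minus 0 and e, where e = (1, ..., 1) is [const_mx 1]. *)
Definition kapGamma (n : nat) : finType :=
  {u : 'rV['F_2]_n | (u != 0) && (u != const_mx 1)}.

Definition kap1 (K : fieldType) (n : nat) := {ffun kapGamma n -> K^o}.

HB.instance Definition _ (K : fieldType) (n : nat) :=
  Vector.copy (kap1 K n) {ffun kapGamma n -> K^o}.

Definition kap_e {K : fieldType} {n : nat} (u : kapGamma n) : kap1 K n :=
  [ffun v => (v == u)%:R].

Definition kap_bracket_e {K : fieldType} {n : nat} (u v : kapGamma n) : kap1 K n :=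
  if u == v then 0
  else if insub (val u + val v) is Some w
       then (kapB (val u) (val v) : nat)%:R *: kap_e w
       else 0.

Definition kap_bracket {K : fieldType} {n : nat} (x y : kap1 K n) : kap1 K n :=
  \sum_(u : kapGamma n) \sum_(v : kapGamma n)
    ((x u : K) * (y v : K)) *: kap_bracket_e u v.

(* The function \prod_i (1 + z_i) ^ u_i; the entry u_i of 'F_2 is read as the
   exponent 0 or 1. *)
Definition kap_fun {K : fieldType} {n : nat} (u : 'rV['F_2]_n) : trunc K n :=
  \prod_(i < n) (1 + zvar i) ^+ (u 0 i : nat).

(* Main.v *)
Require Import Defs.
From HB Require Import structures.
From mathcomp Require Import all_boot all_order all_algebra.

Set Implicit Arguments.
Unset Strict Implicit.
Unset Printing Implicit Defensive.

Import GRing.Theory.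
Local Open Scope ring_scope.

(** The generating function F = \prod_i (1 + z_i)^{u_i} satisfies
    (1 + z_i) dF/dz_i = u_i F, and (1 + z_i)^2 = 1 in characteristic 2.  Hence
    the functions f_u multiply like the group F_2^n, each summand of
    {f_u, f_v} is u_i v_i f_{u+v}, and {f_u, f_v} = B(u, v) f_{u+v}
    ([poisson_kap_fun]).  Since F |-> H_F takes {,} to the bracket of vector
    fields and kills only the constants, this is the Kaplansky bracket: if
    u = v the result is constant, and if u + v = e then B(u, v) = 0
    ([hamilton_kap_bracket_e]).

    It remains to identify the image.  The prolong consists of all the fields
    H_F ([lhIP]).  Each homogeneous component D is closed, that is,
    d_i D_j = d_j D_i: in degree 0 this is the symmetry of the matrices, and it
    goes up by induction on the degree because the brackets [D, d_j] determine
    the derivatives of D.  A closed form on the truncated algebra is exact as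
    soon as d_i D_i = 0 for all i ([poincare]); this extra condition comes from
    the zero diagonals, that is, from taking the derived algebra in degree 0.
    A bracket {F, G} never contains the top monomial z_1 ... z_n, because
    d_i F d_i G does not involve z_i; conversely, a monomial z_S missing some z_i
    is the bracket {z_i z_S, z_i}.  So the derived algebra is the set of the H_F
    where F has no top monomial.

    Finally the f_u and the monomials z_S are two bases exchanged by the linear
    involution [shift], formally z_i |-> 1 + z_i.  It preserves the coefficient
    of the top monomial, so the F without top monomial are the combinations of
    the f_u with u <> e, and the constants are the multiples of f_0.  This gives
    both injectivity ([kap_vect_inj]) and the image ([lhI'P]). *)

(** * Partial derivatives, generating functions and the Poisson bracket *)

Section Calculus.
Variables (K : fieldType) (n : nat).
Implicit Types (i j : 'I_n) (S T : {set 'I_n}) (F G : trunc K n) (D E : vect K n).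

Lemma pderiv_is_linear i : linear (@pderiv K n i).
Proof.
move=> a F G; apply/ffunP=> S; rewrite !ffunE.
by case: ifP => // _; rewrite scaler0 addr0.
Qed.
HB.instance Definition _ i :=
  GRing.isLinear.Build K (trunc K n) (trunc K n) *:%R (@pderiv K n i)
    (@pderiv_is_linear i).

Lemma hamilton_is_linear : linear (@hamilton K n).
Proof. by move=> a F G; apply/ffunP=> i; rewrite !ffunE linearP. Qed.
HB.instance Definition _ :=
  GRing.isLinear.Build K (trunc K n) (vect K n) *:%R (@hamilton K n)
    hamilton_is_linear.

Lemma pderivC i j F : pderiv i (pderiv j F) = pderiv j (pderiv i F).
Proof.
apply/ffunP=> S; rewrite !ffunE !inE setUCA [j == i]eq_sym.
by case: (i == j) => /=; do 2!case: ifP.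
Qed.

Lemma pderiv_pderiv i F : pderiv i (pderiv i F) = 0.
Proof. by apply/ffunP=> S; rewrite !ffunE !inE eqxx; case: ifP. Qed.

Lemma pderiv_zmon i S :
  pderiv i (zmon S) = (if i \in S then zmon (S :\ i) else 0) :> trunc K n.
Proof.
apply/ffunP=> T; rewrite ffunE; have [iT|iT] := boolP (i \in T).
  case: ifP => iS; rewrite ffunE //; case: eqP => // TS.
  by move: iT; rewrite TS !inE eqxx.
rewrite ffunE; case: ifPn => iS; rewrite ffunE.
  congr (_%:R); congr nat_of_bool; apply/eqP/eqP => [<-|->].
    by rewrite setU1K.
  by rewrite setD1K.
by case: eqP => // E; move: iS; rewrite -E !inE eqxx.
Qed.

Lemma pderiv1 i : pderiv i (1 : trunc K n) = 0.
Proof. by rewrite [1]/(zmon set0) pderiv_zmon inE. Qed.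

Lemma pderiv_zvar i j : pderiv i (zvar j : trunc K n) = (i == j)%:R.
Proof.
rewrite pderiv_zmon inE; case: eqP => [->|_] //=.
by rewrite setDv.
Qed.

Lemma trunc_sum F : F = \sum_S (F S : K) *: zmon S.
Proof. by rewrite {1}[F]trunc_decomp; apply: eq_bigr => S _; rewrite zmonE. Qed.

(** Any nonempty S contains some i, and the coefficient of F at S can be read
    off d_i F at S minus i. *)
Lemma hamilton_eq0 F : hamilton F = 0 -> F = (F set0 : K) *: 1.
Proof.
move=> F0; apply/ffunP=> S; rewrite !ffunE.
have [->|[i iS]] := set_0Vmem S; first by rewrite eqxx [_ *: _]mulr1.
have /negPf-> : S != set0 by apply/set0Pn; exists i.
rewrite scaler0; have /ffunP/(_ i)/ffunP/(_ (S :\ i)) := F0.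
by rewrite !ffunE !inE eqxx setD1K.
Qed.

Lemma hamilton1 : hamilton (1 : trunc K n) = 0.
Proof. by apply/ffunP=> i; rewrite !ffunE pderiv1. Qed.

Definition poisson F G : trunc K n := \sum_i pderiv i F * pderiv i G.

Lemma poisson_suml (I : finType) (c : I -> K) (f : I -> trunc K n) G :
  poisson (\sum_u c u *: f u) G = \sum_u c u *: poisson (f u) G.
Proof.
under [RHS]eq_bigr do rewrite scaler_sumr.
rewrite exchange_big; apply: eq_bigr => i _ /=.
rewrite linear_sum mulr_suml; apply: eq_bigr => u _.
by rewrite linearZ /= scalerAl.
Qed.

Lemma poissonC F G : poisson F G = poisson G F.
Proof. by apply: eq_bigr => i _; rewrite mulrC. Qed.

Lemma poisson_zvar F i : poisson F (zvar i) = pderiv i F.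
Proof.
rewrite /poisson (bigD1 i) //= pderiv_zvar eqxx mulr1 big1 ?addr0 // => j ji.
by rewrite pderiv_zvar (negPf ji) mulr0.
Qed.

Lemma hamilton_zvar i : hamilton (zvar i) = partial i :> vect K n.
Proof. by apply/ffunP=> j; rewrite !ffunE pderiv_zvar. Qed.

(** No summand contains the top monomial: d_i F and d_i G do not involve z_i. *)
Lemma poisson_top F G : poisson F G [set: 'I_n] = 0.
Proof.
rewrite sum_ffunE big1 // => i _; rewrite ffunE /trunc_mul_coef big1 // => A _.
by rewrite !ffunE !inE; case: (i \in A); rewrite ?mul0r ?mulr0.
Qed.

Lemma bracket_partial D i j :
  vect_bracket D (partial i) j = - pderiv i (D j).
Proof.
rewrite ffunE big_split /= big1 ?add0r => [|k _].
  rewrite (bigD1 i) //= ffunE eqxx mul1r big1 ?addr0 // => k ki.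
  by rewrite ffunE (negPf ki) mul0r oppr0.
rewrite ffunE; case: eqP => _; first by rewrite pderiv1 mulr0.
by rewrite linear0 mulr0.
Qed.

Lemma W_partial i : W (partial i : vect K n).
Proof. by apply: memv_span; apply: map_f; rewrite mem_enum. Qed.

Lemma WP D : W D <-> exists a : 'I_n -> K, D = hamilton (\sum_i a i *: zvar i).
Proof.
split=> [WD|[a ->]]; last first.
  rewrite linear_sum; apply: memv_suml => i _; rewrite linearZ /= memvZ //.
  by rewrite hamilton_zvar W_partial.
exists (fun i => D i set0).
suff DE i S : S != set0 -> D i S = 0.
  (* a field with constant coefficients is determined by its values at set0 *)
  apply/ffunP=> i; rewrite ffunE linear_sum /= (bigD1 i) //= big1 => [|j ji].
    rewrite linearZ /= pderiv_zvar eqxx addr0; apply/ffunP=> S; rewrite !ffunE.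
    case: eqP => [->|/eqP/DE->]; first by rewrite [_ *: _]mulr1.
    by rewrite scaler0.
  by rewrite linearZ /= pderiv_zvar eq_sym (negPf ji) scaler0.
move=> /negPf S0; have := coord_span (X := in_tuple _) WD => ->.
rewrite !sum_ffunE big1 // => k _; rewrite !ffunE.
have /mapP[j _ ->] : (in_tuple [seq partial i | i : 'I_n])`_k
    \in [seq (partial i : vect K n) | i : 'I_n] by rewrite mem_nth.
by rewrite ffunE; case: eqP; rewrite !ffunE ?S0 scaler0.
Qed.

End Calculus.

(** * Characteristic 2: the bracket of Hamiltonian fields, closed fields *)

Section CharTwo.
Variables (K : fieldType) (n : nat).
Hypothesis char2 : 2%N \in [pchar K].
Implicit Types (i j : 'I_n) (S T : {set 'I_n}) (F G : trunc K n) (D E : vect K n).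

Lemma addvv (V : lmodType K) (x : V) : x + x = 0.
Proof. by rewrite -mulr2n -scaler_nat (pcharf0 char2) scale0r. Qed.

Lemma oppv (V : lmodType K) (x : V) : - x = x.
Proof. by apply/eqP; rewrite eq_sym -subr_eq0 opprK addvv. Qed.

(** By the Leibniz rule, d_j of d_i F d_i G is the i-th summand of the j-th
    coefficient of [H_F, H_G], up to a sign. *)
Lemma bracket_hamilton F G :
  vect_bracket (hamilton F) (hamilton G) = hamilton (poisson F G).
Proof.
apply/ffunP=> j; rewrite !ffunE linear_sum; apply: eq_bigr => i _ /=.
rewrite !ffunE pderivM // oppv addrC mulrC (pderivC i j F) (pderivC i j G).
by [].
Qed.

(** Exactness of closed forms fails on the truncated algebra only because of
    the forms z_i dz_i, whose primitive would be the divided square of z_i; the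
    first hypothesis excludes them.  The coefficient of the primitive at S is
    that of D_i at S minus i, for any i in S: closedness makes it independent
    of the choice. *)
Lemma poincare D :
    (forall i, pderiv i (D i) = 0) ->
    (forall i j, pderiv i (D j) = pderiv j (D i)) ->
  exists F, D = hamilton F.
Proof.
move=> D0 Dsym.
pose potential (S : {set 'I_n}) : K :=
  if [pick i in S] is Some i then D i (S :\ i) else 0.
exists ([ffun S => potential S] : trunc K n).
apply/ffunP=> i; apply/ffunP=> S; rewrite !ffunE /potential.
case: ifPn => iS.
  by move/ffunP/(_ (S :\ i)): (D0 i); rewrite !ffunE !inE eqxx setD1K.
case: pickP => [j|/(_ i)]; last by rewrite !inE eqxx.
rewrite !inE; case: eqVneq => [->|ji] /= jS; first by rewrite setU1K.
move/ffunP/(_ (S :\ j)): (Dsym j i); rewrite !ffunE !inE eqxx.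
rewrite (negPf iS) andbF setD1K //= => ->; congr (D j _).
by apply/setP=> k; rewrite !inE; case: eqVneq => // ->; rewrite eq_sym ji.
Qed.

(** * The degree 0 component: symmetric matrices with zero diagonal *)

(** A linear map whose kernel is the space of symmetric matrices with zero
    diagonal, used to present that space as a [vspace]. *)
Definition alt_defect (A : 'M[K]_n) : 'M[K]_n :=
  \matrix_(i, j) (if i == j then A i i else A i j - A j i).

Lemma alt_defect_is_linear : linear alt_defect.
Proof.
move=> a A B; apply/matrixP=> i j; rewrite !mxE; case: eqP => // _.
by rewrite mulrBr opprD addrACA.
Qed.
HB.instance Definition _ :=
  GRing.isLinear.Build K 'M[K]_n 'M[K]_n *:%R alt_defect alt_defect_is_linear.

Lemma alt_defectP (A : 'M[K]_n) :
  reflect ((forall i, A i i = 0) /\ (forall i j, A i j = A j i))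
          (alt_defect A == 0).
Proof.
apply: (iffP eqP) => [/matrixP A0|[A0 As]]; last first.
  by apply/matrixP=> i j; rewrite !mxE A0 (As i j) subrr if_same.
split=> [i|i j]; first by have := A0 i i; rewrite !mxE eqxx.
case: (eqVneq i j) => [->//|ij].
by have := A0 i j; rewrite !mxE (negPf ij) => /subr0_eq.
Qed.

Lemma oIP (A : 'M[K]_n) : oI A <-> A^T = A.
Proof.
rewrite /oI mulmx1 mul1mx; split=> [/eqP|->]; last exact: addvv.
by rewrite addr_eq0 (oppv A) => /eqP.
Qed.

(** If B and C are symmetric then [B, C] = BC + (BC)^T, which is symmetric with
    diagonal entries 2 (BC)_ii = 0.  Conversely E_ij + E_ji is the bracket of
    the symmetric matrices E_ii and E_ij + E_ji when i <> j, and these elements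
    span. *)
Lemma derived_oIP (A : 'M[K]_n) :
  derived mx_bracket (@oI K n) A <-> alt_defect A == 0.
Proof.
split=> [dA|/alt_defectP[A0 As] U UP].
  suff: A \in lker (linfun alt_defect) by rewrite memv_ker lfunE.
  apply: dA => B C /oIP Bs /oIP Cs; rewrite memv_ker lfunE; apply/alt_defectP.
  have CB : C *m B = (B *m C)^T by rewrite trmx_mul Bs Cs.
  rewrite /mx_bracket (oppv (C *m B)) CB; split=> [i|i j]; rewrite !mxE ?addvv //.
    exact: (addvv (V := K^o)).
  by rewrite addrC.
pose Up : 'M[K]_n := \matrix_(i, j) (if (i < j)%N then A i j else 0).
have -> : A = Up + Up^T.
  apply/matrixP=> i j; rewrite !mxE (As j i).
  by have [ij|ji|/val_inj->] := ltngtP i j; rewrite ?addr0 ?add0r.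
rewrite (matrix_sum_delta Up) !linear_sum -big_split /=.
apply: memv_suml => i _; rewrite linear_sum -big_split /=.
apply: memv_suml => j _; rewrite linearZ /= -scalerDr mxE trmx_delta.
case: ifP => [ij|_]; last by rewrite scale0r mem0v.
have /negPf nij : i != j by apply: contraTneq ij => ->; rewrite ltnn.
rewrite memvZ //.
have -> : delta_mx i j + delta_mx j i =
    mx_bracket (delta_mx i i) (delta_mx i j + delta_mx j i) :> 'M[K]_n.
  rewrite /mx_bracket mulmxDl mulmxDr !mul_delta_mx_cond eqxx (eq_sym j) nij.
  by rewrite !mulr0n !mulr1n addr0 add0r (oppv (delta_mx j i)).
apply: UP; apply/oIP; rewrite ?linearD /= !trmx_delta //.
by rewrite addrC.
Qed.

(** * The prolong consists of the Hamiltonian fields *)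

Lemma oI'_hamilton D : oI' D -> exists F, D = hamilton F.
Proof.
case=> A /derived_oIP/alt_defectP[A0 As] [_ act].
have dD i j : pderiv i (D j) = A j i *: 1.
  move/ffunP/(_ j): (act i); rewrite bracket_partial sum_ffunE (bigD1 j) //=.
  rewrite big1 => [|k kj]; last first.
    by rewrite !ffunE eq_sym (negPf kj) scaler0.
  by rewrite !ffunE eqxx addr0 (oppv (pderiv i _)).
by apply: poincare => [i|i j]; rewrite !dD ?A0 ?scale0r // As.
Qed.

(** The derivatives of D in the direction k are the coefficients of
    some H_F, hence closed; so d_k kills d_i D_j - d_j D_i as well as d_i D_i,
    for every k.  These are then constants, and they vanish because D has
    coefficients of degree at least 2. *)
Lemma hamilton_of_brackets D (d : nat) :
    vect_homog d.+2 D ->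
    (forall i, exists F, vect_bracket D (partial i) = hamilton F) ->
  exists F, D = hamilton F.
Proof.
move=> Dd DF.
have dD i : exists F, forall j, pderiv i (D j) = pderiv j F.
  have [F /ffunP DiF] := DF i; exists F => j.
  by have := DiF j; rewrite bracket_partial ffunE oppv.
have eq0 (f : trunc K n) : (forall i, pderiv i f = 0) -> f set0 = 0 -> f = 0.
  move=> f0 f00; have -> : f = (f set0 : K) *: 1.
    by apply: hamilton_eq0; apply/ffunP=> i; rewrite !ffunE f0.
  by rewrite f00 scale0r.
have low i j : pderiv i (D j) set0 = 0.
  rewrite !ffunE inE setU0; case: (eqVneq (D j [set i]) 0) => // /Dd.
  by rewrite cards1.
apply: poincare => [i|i j].
  apply: eq0 => // k; have [F kF] := dD k.
  by rewrite pderivC kF pderiv_pderiv.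
apply/subr0_eq/eq0 => [k|].
  have [F kF] := dD k.
  by rewrite linearB /= !(pderivC k) !kF (pderivC i) subrr.
by move: (low i j) (low j i); rewrite !ffunE => -> ->; rewrite subrr.
Qed.

Lemma prolong_comp_hamilton d D :
  prolong_comp (@oI' K n) d D -> exists F, D = hamilton F.
Proof.
elim: d D => [|[|d] IHd] D.
- by move/WP=> [a ->]; eexists.
- exact: oI'_hamilton.
- case=> Dd DW; apply: hamilton_of_brackets Dd _ => i.
  exact/IHd/DW/W_partial.
Qed.

Definition homog d F : Prop := forall S, F S != 0 -> #|S| = d.

Lemma homogD d F G : homog d F -> homog d G -> homog d (F + G).
Proof.
move=> Fd Gd S; rewrite ffunE; have [F0|/Fd//] := eqVneq (F S) 0.
by rewrite F0 add0r => /Gd.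
Qed.

Lemma homogZ d a F : homog d F -> homog d (a *: F).
Proof.
by move=> Fd S; rewrite ffunE scaler_eq0 negb_or => /andP[_ /Fd].
Qed.

Lemma homog_sum (I : finType) d (f : I -> trunc K n) :
  (forall u, homog d (f u)) -> homog d (\sum_u f u).
Proof.
move=> fd; elim/big_ind: _ => // [S|]; first by rewrite ffunE eqxx.
exact: homogD.
Qed.

Lemma homog_pderiv d i F : homog d.+1 F -> homog d (pderiv i F).
Proof.
move=> Fd S; rewrite ffunE; case: ifPn => [_|iS /Fd]; first by rewrite eqxx.
by rewrite cardsU1 iS => -[].
Qed.

Lemma homog_hamilton d F : homog d.+1 F -> vect_homog d (hamilton F).
Proof. by move=> Fd i S; rewrite ffunE => /(homog_pderiv Fd). Qed.

Lemma homog1_W F : homog 1 F -> W (hamilton F).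
Proof.
move=> F1; apply/WP; exists (fun i => F [set i]); congr hamilton.
apply/ffunP=> S; rewrite sum_ffunE; have [S1|S1] := boolP (#|S| == 1%N).
  have /cards1P[i ->] := S1; rewrite (bigD1 i) //= !ffunE eqxx [_ *: _]mulr1.
  rewrite big1 ?addr0 // => j ji; rewrite !ffunE (inj_eq set1_inj) eq_sym.
  by rewrite (negPf ji) scaler0.
have -> : F S = 0 by apply: contraNeq S1 => /F1->.
rewrite big1 // => i _; rewrite !ffunE; case: eqP => [Si|]; last by rewrite scaler0.
by rewrite Si cards1 in S1.
Qed.

Lemma homog2_oI' F : homog 2 F -> oI' (hamilton F).
Proof.
move=> F2; pose A : 'M[K]_n := \matrix_(i, j) (pderiv j (pderiv i F) set0).
exists A.
  apply/derived_oIP/alt_defectP; split=> [i|i j]; rewrite !mxE.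
    by rewrite pderiv_pderiv ffunE.
  by rewrite pderivC.
split=> [|j]; first exact: homog_hamilton.
have ddF0 i : homog 0 (pderiv j (pderiv i F)) by do 2!apply: homog_pderiv.
apply/ffunP=> i; rewrite bracket_partial ffunE oppv sum_ffunE (bigD1 i) //=.
rewrite big1 => [|k ki]; last by rewrite !ffunE eq_sym (negPf ki) scaler0.
rewrite addr0 ffunE ffunE eqxx mxE; apply: hamilton_eq0.
apply/ffunP=> k; rewrite ffunE [RHS]ffunE; apply/ffunP=> S; rewrite ffunE [RHS]ffunE.
case: ifPn => // kS; apply/eqP; apply: contraT => /ddF0/eqP.
by rewrite cards_eq0 => /eqP E; have := setU11 k S; rewrite E inE.
Qed.

(** The bracket with a constant field sum_i a_i d_i is {F, sum_i a_i z_i}, of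
    degree one less than F, which gives the induction step. *)
Lemma homog_prolong_comp d F :
  homog d.+1 F -> prolong_comp (@oI' K n) d (hamilton F).
Proof.
elim: d F => [|[|d] IHd] F Fd; [exact: homog1_W|exact: homog2_oI'|].
split=> [|E /WP[a ->]]; first exact: homog_hamilton.
rewrite bracket_hamilton // poissonC poisson_suml; apply: IHd.
apply: homog_sum => i; apply: homogZ.
by rewrite poissonC poisson_zvar; apply: homog_pderiv.
Qed.

Definition homog_part d F : trunc K n :=
  \sum_(S : {set 'I_n} | #|S| == d) (F S : K) *: zmon S.

Lemma homog_homog_part d F : homog d (homog_part d F).
Proof.
move=> S; rewrite sum_ffunE; apply: contraNeq => /negPf Sd.
rewrite big1 // => T Td; rewrite !ffunE; case: eqP => [ST|]; last by rewrite scaler0.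
by rewrite ST Td in Sd.
Qed.

Lemma sum_homog_part F : F = \sum_(d < n.+1) homog_part d F.
Proof.
rewrite {1}[F]trunc_sum.
rewrite (partition_big (fun S : {set 'I_n} => inord #|S| : 'I_n.+1) xpredT) //=.
apply: eq_bigr => d _; apply: eq_bigl => S; rewrite -val_eqE /= inordK //.
by rewrite ltnS -[n in (_ <= n)%N]card_ord max_card.
Qed.

Lemma lhIP D : @lhI K n D <-> exists F, D = hamilton F.
Proof.
split=> [[m [c [cP ->]]]|[F ->]].
  elim/big_ind: _ => [|_ _ [F ->] [G ->]|d _].
  - by exists 0; rewrite linear0.
  - by exists (F + G); rewrite linearD.
  - exact: prolong_comp_hamilton (cP d).
(* a generating function of degree d.+1 gives the component of index d *)
exists n, (fun d => hamilton (homog_part d.+1 F)); split=> [d|].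
  exact/homog_prolong_comp/homog_homog_part.
have const0 : hamilton (homog_part 0 F) = 0.
  rewrite linear_sum big1 // => S; rewrite cards_eq0 linearZ /= => /eqP->.
  by rewrite [hamilton _]hamilton1 scaler0.
rewrite [in LHS](sum_homog_part F) linear_sum big_ord_recl.
by rewrite [X in X + _]const0 add0r.
Qed.

(** * The basis of products of the 1 + z_i *)

Definition unimon S : trunc K n := \prod_(i in S) (1 + zvar i).

Lemma prod1D (a : 'I_n -> trunc K n) S :
  \prod_(i in S) (1 + a i) = \sum_(T : {set 'I_n} | T \subset S) \prod_(i in T) a i.
Proof.
rewrite big_mkcond /= [LHS](eq_bigr (fun i => (if i \in S then a i else 0) + 1)).
  rewrite bigA_distr /= [RHS]big_mkcond /=; apply: eq_bigr => T _.
  case: ifPn => [TS|/subsetPn[i iT iS]].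
    rewrite [RHS]big_mkcond; apply: eq_bigr => i _; case: ifP => // iT.
    by rewrite (subsetP TS).
  by rewrite (bigD1 i) //= iT (negPf iS) mul0r.
by move=> i _; case: ifP => _; rewrite ?add0r // addrC.
Qed.

Lemma unimon_sum S : unimon S = \sum_(T : {set 'I_n} | T \subset S) zmon T.
Proof. by rewrite /unimon prod1D; apply: eq_bigr => T _; rewrite zmonE. Qed.

Lemma zmon_sum S : zmon S = \sum_(T : {set 'I_n} | T \subset S) unimon T.
Proof.
rewrite -prod1D zmonE; apply: eq_bigr => i _.
by rewrite addrA (addvv (1 : trunc K n)) add0r.
Qed.

(** On the monomial basis this is the substitution z_i |-> 1 + z_i.  It is only a
    linear map, not an algebra endomorphism: z_i^2 = 0 but (1 + z_i)^2 = 1. *)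
Definition shift F : trunc K n := \sum_S (F S : K) *: unimon S.

Lemma shift_is_linear : linear shift.
Proof.
move=> a F G; rewrite /shift scaler_sumr -big_split; apply: eq_bigr => S _ /=.
by rewrite !ffunE scalerDl scalerA.
Qed.
HB.instance Definition _ :=
  GRing.isLinear.Build K (trunc K n) (trunc K n) *:%R shift shift_is_linear.

Lemma shift_zmon S : shift (zmon S) = unimon S.
Proof.
rewrite /shift (bigD1 S) //= ffunE eqxx scale1r big1 ?addr0 // => T TS.
by rewrite ffunE (negPf TS) scale0r.
Qed.

(** The expansions of \prod_(i in S) (1 + z_i) in the z_T and of
    z_S = \prod_(i in S) (1 + (1 + z_i)) in the products of the 1 + z_i have
    the same form, a sum over the subsets T of S. *)
Lemma shiftK : involutive shift.
Proof.
move=> F; rewrite [X in shift X]/shift linear_sum [RHS]trunc_sum; apply: eq_bigr => S _.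
rewrite linearZ /=; congr (_ *: _).
rewrite unimon_sum linear_sum /= zmon_sum.
by apply: eq_bigr => T _; rewrite shift_zmon.
Qed.

Lemma shift_top F : shift F [set: 'I_n] = F [set: 'I_n].
Proof.
rewrite sum_ffunE (bigD1 setT) //= big1 => [|S ST]; rewrite ffunE unimon_sum.
  rewrite sum_ffunE (bigD1 setT) //= ffunE eqxx big1 ?addr0 => [|T /andP[_ TT]].
    exact: mulr1.
  by rewrite ffunE eq_sym (negPf TT).
rewrite sum_ffunE big1 ?scaler0 // => T TS; rewrite ffunE; case: eqP => // TT.
by rewrite -TT subTset (negPf ST) in TS.
Qed.

(** * Bracket of the functions attached to vectors of F_2^n *)

Implicit Types u v : 'rV['F_2]_n.

Definition supp u : {set 'I_n} := [set i | u 0 i != 0].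

Lemma F2_cases (a : 'F_2) : a = 0 \/ a = 1.
Proof. by case: a => [[|[|[]]]] // ?; [left|right]; apply: val_inj. Qed.

Lemma supp_inj : injective supp.
Proof.
move=> u v /setP uv; apply/rowP=> i; have := uv i; rewrite !inE.
by case: (F2_cases (u 0 i)) (F2_cases (v 0 i)) => -> [] ->.
Qed.

Lemma supp_row S : supp (\row_i (i \in S)%:R) = S.
Proof. by apply/setP=> i; rewrite inE mxE; case: (i \in S). Qed.

Lemma supp0 : supp 0 = set0.
Proof. by apply/setP=> i; rewrite !inE mxE eqxx. Qed.

Lemma supp1 : supp (const_mx 1) = setT.
Proof. by apply/setP=> i; rewrite !inE mxE. Qed.

Lemma kap_fun_unimon u : kap_fun u = unimon (supp u).
Proof.
rewrite /unimon big_mkcond; apply: eq_bigr => i _; rewrite inE.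
by case: (F2_cases (u 0 i)) => ->.
Qed.

Lemma sqr_1Dz i : (1 + zvar i) * (1 + zvar i) = 1 :> trunc K n.
Proof.
rewrite mulrDl mul1r mulrDr mulr1 -expr2 zvar_sqr addr0 -addrA.
by rewrite (addvv (zvar i : trunc K n)) addr0.
Qed.

Lemma kap_funD u v : kap_fun (u + v) = kap_fun u * kap_fun v :> trunc K n.
Proof.
rewrite -big_split; apply: eq_bigr => i _; rewrite mxE.
case: (F2_cases (u 0 i)) (F2_cases (v 0 i)) => -> [] ->.
- exact/esym/mul1r.
- exact/esym/mul1r.
- exact/esym/mulr1.
- exact/esym/sqr_1Dz.
Qed.

(** The logarithmic derivative of f_u is u_i (1 + z_i)^-1 = u_i (1 + z_i). *)
Lemma pderiv_kap_fun i u :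
  pderiv i (kap_fun u) = (u 0 i : nat)%:R *: ((1 + zvar i) * kap_fun u) :> trunc K n.
Proof.
rewrite /kap_fun (bigD1 i) //=; set R := \prod_(j < n | _) _.
have dR : pderiv i R = 0.
  rewrite /R; elim/big_ind: _ => [|f g f0 g0|j ji]; first exact: pderiv1.
    by rewrite pderivM // f0 g0 mul0r mulr0 addr0.
  case: (F2_cases (u 0 j)) => ->; first exact: pderiv1.
  by rewrite linearD /= pderiv1 pderiv_zvar eq_sym (negPf ji) addr0.
rewrite pderivM // dR mulr0 addr0; case: (F2_cases (u 0 i)) => ->.
  by rewrite pderiv1 mul0r scale0r.
by rewrite linearD /= pderiv1 pderiv_zvar eqxx add0r mulrA sqr_1Dz scale1r.
Qed.

Lemma F2_natrD (a b : 'F_2) : (nat_of_ord (a + b)%R)%:R = a%:R + b%:R :> K.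
Proof.
case: (F2_cases a) (F2_cases b) => -> [] ->; rewrite ?addr0 ?add0r //.
by rewrite (addvv (V := K^o)).
Qed.

Lemma F2_natrM (a b : 'F_2) : (nat_of_ord (a * b)%R)%:R = a%:R * b%:R :> K.
Proof. by case: (F2_cases a) (F2_cases b) => -> [] ->; rewrite ?mulr0 ?mulr1. Qed.

Lemma poisson_kap_fun u v :
  poisson (kap_fun u) (kap_fun v) = (kapB u v : nat)%:R *: kap_fun (u + v) :> trunc K n.
Proof.
rewrite /kapB (big_morph _ F2_natrD (erefl _)) scaler_suml; apply: eq_bigr => i _.
rewrite !pderiv_kap_fun -scalerAl -scalerAr scalerA mulrACA sqr_1Dz mul1r.
by rewrite F2_natrM kap_funD.
Qed.

(** * The embedding of the Kaplansky algebra and its image *)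

Definition kap_gen (x : kap1 K n) : trunc K n := \sum_w (x w : K) *: kap_fun (val w).

Lemma kap_gen_is_linear : linear kap_gen.
Proof.
move=> a x y; rewrite /kap_gen scaler_sumr -big_split; apply: eq_bigr => w _ /=.
by rewrite !ffunE scalerDl scalerA.
Qed.
HB.instance Definition _ :=
  GRing.isLinear.Build K (kap1 K n) (trunc K n) *:%R kap_gen kap_gen_is_linear.

Definition kap_vect : kap1 K n -> vect K n := hamilton \o kap_gen.
HB.instance Definition _ := GRing.Linear.on kap_vect.

Lemma kap_gen_e w : kap_gen (kap_e w) = kap_fun (val w).
Proof.
rewrite /kap_gen (bigD1 w) //= ffunE eqxx scale1r big1 ?addr0 // => v vw.
by rewrite ffunE (negPf vw) scale0r.
Qed.

(** [shift] turns f_u into the monomial of the support of u, so it reads the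
    coordinates of x back from its generating function. *)
Lemma shift_kap_gen x w : shift (kap_gen x) (supp (val w)) = x w.
Proof.
have -> : shift (kap_gen x) = \sum_v (x v : K) *: zmon (supp (val v)).
  rewrite linear_sum; apply: eq_bigr => v _.
  by rewrite linearZ /= kap_fun_unimon -shift_zmon shiftK.
rewrite sum_ffunE (bigD1 w) //= !ffunE eqxx big1 => [|v vw].
  by rewrite addr0 [_ *: _]mulr1.
by rewrite !ffunE (inj_eq supp_inj) (inj_eq val_inj) eq_sym (negPf vw) scaler0.
Qed.

Lemma shift_kap_gen_eq0 x S :
  (S == set0) || (S == setT) -> shift (kap_gen x) S = 0.
Proof.
move=> S0T; rewrite linear_sum sum_ffunE big1 // => v _.
rewrite linearZ /= kap_fun_unimon -shift_zmon shiftK !ffunE.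
case: eqP => [Sv|]; last by rewrite scaler0.
have := valP v; rewrite -!(inj_eq supp_inj) supp0 supp1 -Sv -negb_or.
by rewrite S0T.
Qed.

Lemma shift_const (a : K) : shift (a *: 1) = a *: 1.
Proof. by rewrite linearZ /= [1]/(zmon set0) shift_zmon /unimon big_set0. Qed.

Lemma kap_vect_inj : injective kap_vect.
Proof.
move=> x y; apply: contra_eq => xy; rewrite -subr_eq0 -linearB.
apply: contra_neq xy => /hamilton_eq0 xy; apply/subr0_eq/ffunP=> w.
rewrite -shift_kap_gen xy shift_const !ffunE; case: eqP => [w0|]; last first.
  by rewrite scaler0.
have := valP w; rewrite -(inj_eq supp_inj) supp0.
by rewrite w0 eqxx.
Qed.

Lemma kap_gen_top x : kap_gen x setT = 0.
Proof. by rewrite -shift_top shift_kap_gen_eq0 // eqxx orbT. Qed.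

(** The coordinates of x are those of F in the basis of the f_u; the coordinate
    at e vanishes with F setT, and the one at 0 only adds a constant to F. *)
Lemma hamilton_kap_vect F : F setT = 0 -> exists x, hamilton F = kap_vect x.
Proof.
move=> FT; pose x : kap1 K n := [ffun w => shift F (supp (val w))].
exists x; pose a : K := shift F set0.
suff FE : shift F = shift (kap_gen x) + a *: (1 : trunc K n).
  rewrite -[F]shiftK FE linearD /= shiftK linearD /= shift_const linearZ /=.
  by rewrite hamilton1 scaler0 addr0.
apply/ffunP=> S; rewrite !ffunE [RHS]/=.
have [->|S0] := eqVneq S set0.
  by rewrite shift_kap_gen_eq0 ?eqxx // add0r [_ *: _]mulr1.
rewrite scaler0 addr0; have [->|ST] := eqVneq S setT.
  by rewrite shift_kap_gen_eq0 ?eqxx ?orbT // shift_top.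
pose u : 'rV['F_2]_n := \row_i (i \in S)%:R.
have uG : (u != 0) && (u != const_mx 1).
  by rewrite -!(inj_eq supp_inj) supp0 supp1 supp_row S0.
have -> : S = supp (val (Sub u uG : kapGamma n)) by rewrite SubK supp_row.
by rewrite shift_kap_gen ffunE.
Qed.

(** Brackets of generating functions have no top monomial.  Conversely, a
    monomial z_S other than the top one misses some z_i, and is the bracket of
    z_i z_S and z_i. *)
Lemma lhI'P D : @lhI' K n D <-> exists x, D = kap_vect x.
Proof.
split=> [dD|[x ->] U UP].
  suff /memv_imgP[x _ ->] : D \in limg (linfun kap_vect).
    by exists x; rewrite lfunE.
  apply: dD => _ _ /lhIP[F ->] /lhIP[G ->]; rewrite bracket_hamilton.
  have [x ->] := hamilton_kap_vect (poisson_top F G).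
  by rewrite -(lfunE kap_vect) memv_img ?memvf.
rewrite /kap_vect /= [kap_gen x]trunc_sum linear_sum; apply: memv_suml => S _.
rewrite linearZ /=; have [->|ST] := eqVneq S setT.
  by rewrite kap_gen_top scale0r mem0v.
have /subsetPn[i _ iS] : ~~ (setT \subset S) by rewrite subTset.
rewrite memvZ //.
have -> : hamilton (zmon S) =
    vect_bracket (hamilton (zmon (i |: S))) (hamilton (zvar i)) :> vect K n.
  by rewrite bracket_hamilton poisson_zvar pderiv_zmon setU11 setU1K.
by apply: UP; apply/lhIP; eexists.
Qed.

(** The two cases where the Kaplansky bracket is set to 0 agree with the general
    formula: f_{u+u} = 1 generates the zero field, and B(u, v) = 0 when
    u + v = e. *)
Lemma hamilton_kap_bracket_e (w w' : kapGamma n) :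
  kap_vect (kap_bracket_e w w') =
  hamilton (poisson (kap_fun (val w)) (kap_fun (val w'))).
Proof.
rewrite poisson_kap_fun linearZ /= /kap_bracket_e; case: eqVneq => [<-|ww'].
  rewrite linear0 (_ : kap_fun _ = 1) ?hamilton1 ?scaler0 //.
  rewrite kap_funD /kap_fun -big_split big1 //= => i _.
  by rewrite -exprMn sqr_1Dz expr1n.
case: insubP => [s _ <-|]; first by rewrite linearZ /= /kap_vect /= kap_gen_e.
rewrite negb_and !negbK linear0 => /orP[/eqP uv|/eqP uv].
  by rewrite uv /kap_fun big1 ?hamilton1 ?scaler0 // => i _; rewrite mxE.
(* if u + v = e then u and v have complementary supports *)
rewrite (_ : kapB _ _ = 0) ?scale0r //; apply: big1 => i _.
have : sval w 0 i + sval w' 0 i = 1 by have /rowP/(_ i) := uv; rewrite !mxE.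
case: (F2_cases (sval w 0 i)) (F2_cases (sval w' 0 i)) => -> [] ->;
  by rewrite ?mul0r ?mulr0 // => /(congr1 val).
Qed.

Lemma kap_vect_bracket x y :
  kap_vect (kap_bracket x y) = vect_bracket (kap_vect x) (kap_vect y).
Proof.
rewrite bracket_hamilton poisson_suml !linear_sum; apply: eq_bigr => w _ /=.
rewrite poissonC poisson_suml scaler_sumr !linear_sum; apply: eq_bigr => w' _ /=.
by rewrite scalerA !linearZ /= poissonC hamilton_kap_bracket_e.
Qed.

End CharTwo.

Theorem mainTheorem4 (K : closedFieldType) (char2 : 2%N \in [pchar K])
    (n : nat) (n_ge4 : (4 <= n)%N) :
  exists phi : {linear kap1 K n -> vect K n},
    [/\ injective phi,
        forall D : vect K n, lhI' K n D <-> exists x, D = phi x,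
        forall x y, phi (kap_bracket x y) = vect_bracket (phi x) (phi y)
      & forall u : kapGamma n, phi (kap_e u) = hamilton (kap_fun (val u))].
Proof.
exists (@kap_vect K n); split.
- exact: kap_vect_inj.
- exact: lhI'P.
- exact: kap_vect_bracket.
- by move=> u; rewrite -kap_gen_e.
Qed.
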